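(* Let $n,m\geq 2$ be integers. Consider the set $\mathcal{T}_{n,m}$ of all arrays $(a_{i,j})_{(i,j)\in\mathbb{Z}\times\mathbb{Z}}$ of real numbers such that: (1) $a_{i,j}a_{i+1,j+1}-a_{i,j+1}a_{i+1,j}=1$ for all $i,j\in\mathbb{Z}$; (2) $a_{i,j+n}=-a_{i,j}$ and $a_{i+m,j}=-a_{i,j}$ for all $i,j\in\mathbb{Z}$; (3) $a_{i,j}$ is a positive integer for all $0\le i\le m-1$, $0\le j\le n-1$. Consider also the set of triples $(q,q',M)$ where $q=(q_0,\ldots,q_{n-1})$ is a quiddity of order $n$, $q'=(q'_0,\ldots,q'_{m-1})$ is a quiddity of order $m$, and $M=\begin{pmatrix}a&b\\ c&d\end{pmatrix}$ is a $2\times 2$ matrix with positive integer entries and $ad-bc=1$, such that $$q_0<\frac{b}{a},\qquad q'_0<\frac{c}{a}.$$ Then these two sets are in one-to-one correspondence. Explicitly, to a triple $(q,q',M)$ (with $q,q'$ extended periodically: $q_{j+n}=q_j$, $q'_{i+m}=q'_i$) corresponds the unique array $(a_{i,j})$ satisfying $$a_{i,j+1}=q_j a_{i,j}-a_{i,j-1},\qquad a_{i+1,j}=q'_i a_{i,j}-a_{i-1,j}\quad\text{for all } i,j\in\mathbb{Z},$$ and $\begin{pmatrix}a_{0,0}&a_{0,1}\\ a_{1,0}&a_{1,1}\end{pmatrix}=M$; this array lies in $\mathcal{T}_{n,m}$, and every element of $\mathcal{T}_{n,m}$ arises in this way from exactly one such triple.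
   Context: A quiddity of order $n\ge 3$ is a sequence $(q_0,\ldots,q_{n-1})$ of positive integers for which there exists a triangulation (by non-crossing diagonals) of a convex $n$-gon with vertices labelled $0,1,\ldots,n-1$ in cyclic order such that $q_i$ is the number of triangles incident to vertex $i$ for every $i$. By convention, the unique (degenerate) quiddity of order $2$ is $(0,0)$. *)

(* Defs.v *)
From HB Require Import structures.
From mathcomp Require Import all_boot all_order all_algebra.
From mathcomp Require Import boolp classical_sets functions reals.
Set Implicit Arguments.
Unset Strict Implicit.
Unset Printing Implicit Defensive.
Import Order.TTheory GRing.Theory Num.Theory.

Section Polygon.
Variable n : nat.

(* The vertices of the convex n-gon are 'I_n in cyclic order, and a segment
   joining two distinct vertices is the pair (i, j) of its endpoints, i < j. *)
Definition is_side (e : 'I_n * 'I_n) : bool :=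
  (e.1.+1 == e.2 :> nat) || ((e.1 == 0 :> nat) && (e.2.+1 == n)).

Definition is_diagonal (e : 'I_n * 'I_n) : bool := (e.1 < e.2) && ~~ is_side e.

(* By convexity, two diagonals meet in their interiors iff their endpoints
   are distinct and alternate around the polygon. *)
Definition crossing (d e : 'I_n * 'I_n) : bool :=
  [&& d.1 < e.1, e.1 < d.2 & d.2 < e.2] ||
  [&& e.1 < d.1, d.1 < e.2 & e.2 < d.2].

Definition noncrossing_diagonals (D : {set 'I_n * 'I_n}) : bool :=
  [forall d in D, is_diagonal d] &&
  [forall d in D, forall e in D, ~~ crossing d e].

Definition triangulation (D : {set 'I_n * 'I_n}) : bool :=
  maxset noncrossing_diagonals D.

(* By convexity, three vertices joined pairwise by sides of the polygon or
   diagonals of D bound a region that no diagonal of D can enter, so these are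
   the triangles of the dissection. *)
Definition triangles (D : {set 'I_n * 'I_n}) : {set {set 'I_n}} :=
  [set t : {set 'I_n} | (#|t| == 3) &&
     [forall x in t, forall y in t,
        (x < y) ==> is_side (x, y) || ((x, y) \in D)]].

Definition triangles_at (D : {set 'I_n * 'I_n}) (v : 'I_n) : nat :=
  #|[set t in triangles D | v \in t]|.

Definition quiddity (q : n.-tuple nat) : Prop :=
  (n = 2 /\ forall i, tnth q i = 0) \/
  [/\ 3 <= n, forall i, 0 < tnth q i &
      exists2 D, triangulation D & forall i, tnth q i = triangles_at D i].

(* The n-periodic extension of q to all integer indices. *)
Definition perext (q : n.-tuple nat) (j : int) : nat :=
  nth 0 q `|(j %% n%:Z)%Z|.

End Polygon.

Local Open Scope ring_scope.

Definition toric_tiling (R : realType) (n m : nat) : set (int -> int -> R) :=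
  fun a =>
  [/\ forall i j : int, a i j * a (i + 1) (j + 1) - a i (j + 1) * a (i + 1) j = 1,
      forall i j : int, a i (j + n%:Z) = - a i j,
      forall i j : int, a (i + m%:Z) j = - a i j &
      forall i j : int, 0 <= i <= m%:Z - 1 -> 0 <= j <= n%:Z - 1 ->
        0 < a i j /\ a i j \is a Num.int].

Definition triple (n m : nat) : Type :=
  (n.-tuple nat * m.-tuple nat * 'M[int]_2)%type.

Definition admissible (n m : nat) : set (triple n m) :=
  fun '(q, q', M) =>
  [/\ quiddity q, quiddity q',
      (forall k l, 0 < M k l) /\ M 0 0 * M 1 1 - M 0 1 * M 1 0 = 1,
      (perext q 0)%:R < (M 0 1)%:~R / (M 0 0)%:~R :> rat &
      (perext q' 0)%:R < (M 1 0)%:~R / (M 0 0)%:~R :> rat].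

Definition corresponds (R : realType) (n m : nat)
    (t : triple n m) (a : int -> int -> R) : Prop :=
  let '(q, q', M) := t in
  [/\ forall i j : int, a i (j + 1) = (perext q j)%:R * a i j - a i (j - 1),
      forall i j : int, a (i + 1) j = (perext q' i)%:R * a i j - a (i - 1) j &
      \matrix_(k < 2, l < 2) a k%:Z l%:Z = map_mx intr M].

(* Main.v *)
Require Import Defs.
From HB Require Import structures.
From mathcomp Require Import all_boot all_order all_algebra.
From mathcomp Require Import boolp classical_sets functions reals.
From mathcomp Require Import zify ring lra.
Set Implicit Arguments.
Unset Strict Implicit.
Unset Printing Implicit Defensive.
Import Order.TTheory GRing.Theory Num.Theory.

(** Rooting a triangulated polygon at its side [(0, n - 1)] turns triangulations
    into binary trees: the triangle [(a, k, b)] resting on a segment [(a, b)]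
    cuts off the polygons [a..k] and [k..b].  For a sequence [V] satisfying the
    recurrence [V (j + 1) + V (j - 1) = q j * V j] of a quiddity [q], induction
    on the tree gives [V k = V a + V b] at every node, hence positivity between
    [a] and [b], and [V (a + 1) = q a * V a + V b], hence antiperiodicity.

    Conversely, two consecutive rows of a tiling are a chain of positive integer
    vectors [C 0, ..., C (n - 1)] with consecutive determinants [1] and
    [det (C 0, C (n - 1)) = 1].  Some [C k] equals [C 0 + C (n - 1)], and
    splitting the chain there builds the tree recursively.  The determinant
    condition makes the coefficients of the recurrence the same in all rows. *)

(** * Binary trees and recurrences *)

Inductive bintree := Leaf | Node of bintree & bintree.

Fixpoint leaves (t : bintree) : nat :=
  if t is Node l r then leaves l + leaves r else 1.

Lemma leaves_gt0 t : 0 < leaves t.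
Proof. by elim: t => //= l IHl r IHr; rewrite addn_gt0 IHl. Qed.

(* A tree [t] encodes a triangulation of the polygon with vertices
   [a, ..., a + leaves t]: the leaves are its sides other than the root side
   [(a, a + leaves t)], and a node is the triangle resting on the root side of
   its subtree. *)
Fixpoint incidence (a : nat) (t : bintree) (v : nat) : nat :=
  if t is Node l r then
    (v \in [:: a; a + leaves l; a + leaves t])
      + (incidence a l v + incidence (a + leaves l) r v)
  else 0.

Lemma incidence_out a t v :
  (v < a) || (a + leaves t < v) -> incidence a t v = 0.
Proof.
elim: t a => //= l IHl r IHr a h.
have := leaves_gt0 l; have := leaves_gt0 r => hr hl.
rewrite IHl ?IHr; [|lia|lia].
rewrite !inE; lia.
Qed.

Section Recurrence.
Local Open Scope ring_scope.

(** No condition is put at the ends [a] and [b], so that the property restricts to subtrees. *)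
Definition recurrent (R : pzRingType) (q : nat -> nat) (V : nat -> R)
    (a b : nat) :=
  forall j, (a < j < b)%N -> V j.+1 + V j.-1 = (q j)%:R * V j.

(** Strictly inside the range of one subtree, the root triangle and the other subtree contribute
    nothing. At the apex, the root triangle accounts for the [.+1]. *)
Lemma recurrent_node (R : pzRingType) a l r (V : nat -> R) :
    recurrent (incidence a (Node l r)) V a (a + leaves (Node l r)) ->
  [/\ recurrent (incidence a l) V a (a + leaves l),
      recurrent (incidence (a + leaves l) r) V (a + leaves l)
        (a + leaves l + leaves r) &
      let k := (a + leaves l)%N in
      V k.+1 + V k.-1
        = (incidence a l k + incidence k r k).+1%:R * V k].
Proof.
have hl := leaves_gt0 l; have hr := leaves_gt0 r => h.
split.
- move=> j hj; rewrite h /=; last by lia.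
  rewrite (@incidence_out _ r); last by lia.
  rewrite !inE addn0; congr (_%:R * _); lia.
- move=> j hj; rewrite h /=; last by lia.
  rewrite (@incidence_out _ l); last by lia.
  rewrite !inE add0n; congr (_%:R * _); lia.
- rewrite /= h /=; last by lia.
  by rewrite !inE eqxx orbT.
Qed.

(** This is the recurrence at the two ends, where the missing neighbour is the opposite end with its
    sign changed. It is the source of antiperiodicity. *)
Lemma recurrent_ends (R : realDomainType) a t (V : nat -> R) :
    recurrent (incidence a t) V a (a + leaves t) ->
  V a.+1 = (incidence a t a)%:R * V a + V (a + leaves t)%N /\
  V (a + leaves t).-1
    = (incidence a t (a + leaves t))%:R * V (a + leaves t)%N + V a.
Proof.
elim: t a => [|l IHl r IHr] a; first by rewrite /= addn1 !mul0r !add0r.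
move/recurrent_node; case=> /IHl [la lk] /IHr [rk rb] /=.
have hl := leaves_gt0 l; have hr := leaves_gt0 r.
(* By the end relations of both subtrees, [kE] says that the value at the apex is the sum of the
   values at the two ends. Substituting it at the outer ends adds one to each incidence. *)
rewrite !addnA lk rk la rb !inE !eqxx !orbT /= => kE.
rewrite (@incidence_out _ r a); last by lia.
rewrite (@incidence_out _ l (_ + _)%N); last by lia.
move: kE; rewrite !addn0 -natr1 !natrD => kE.
by split; lra.
Qed.

(** The end relations of the two subtrees account for all incidences at the apex but one; the
    remaining multiple of the apex value equals the sum of the end values. *)
Lemma recurrent_apex (R : realDomainType) a l r (V : nat -> R) :
    recurrent (incidence a (Node l r)) V a (a + leaves (Node l r)) ->
  V (a + leaves l)%N = V a + V (a + leaves (Node l r))%N.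
Proof.
move/recurrent_node; case=> /recurrent_ends[_ lk] /recurrent_ends[rk _] /=.
by rewrite lk rk -natr1 natrD addnA; lra.
Qed.

Lemma recurrent_gt0 (R : realDomainType) a t (V : nat -> R) :
    recurrent (incidence a t) V a (a + leaves t) ->
    0 < V a -> 0 < V (a + leaves t)%N ->
  forall j, (a <= j <= a + leaves t)%N -> 0 < V j.
Proof.
elim: t a => [|l IHl r IHr] a.
  move=> _ Va Vb j /= hj; have [->|->] : j = a \/ j = (a + 1)%N by lia.
    by [].
  by [].
move=> h Va Vb j /= hj; have kE := recurrent_apex h.
have Vk : 0 < V (a + leaves l)%N by rewrite kE addr_gt0.
have [hl hr _] := recurrent_node h.
have [jk|kj] := leqP j (a + leaves l); first by apply: (IHl a) => //; lia.
by apply: (IHr (a + leaves l)%N) => //=; [rewrite -addnA | lia].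
Qed.

(** * Unimodular chains of plane vectors *)

Definition wedge (R : pzRingType) (u v : nat -> R) (i j : nat) : R :=
  u i * v j - u j * v i.

(** The slopes [v j / u j] increase along the chain, because consecutive determinants are
    positive. *)
Lemma wedge_gt0 (R : realDomainType) (u v : nat -> R) a b :
    (forall j, (a <= j <= b)%N -> 0 < u j) ->
    (forall j, (a <= j < b)%N -> wedge u v j j.+1 = 1) ->
  forall i j, (a <= i)%N -> (i < j <= b)%N -> 0 < wedge u v i j.
Proof.
move=> u0 w1 i j ai; elim: j => // j IHj hj.
have [ij|ij] := eqVneq i j; first by rewrite -ij w1 ?ltr01 //; lia.
have h1 : 0 < wedge u v i j by apply: IHj; lia.
have h2 : wedge u v j j.+1 = 1 by apply: w1; lia.
have ui : 0 < u i by apply: u0; lia.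
have uj : 0 < u j by apply: u0; lia.
have uj1 : 0 < u j.+1 by apply: u0; lia.
rewrite -(pmulr_rgt0 _ uj).
(* Three-term Pluecker relation. *)
have -> : u j * wedge u v i j.+1
     = u j.+1 * wedge u v i j + u i * wedge u v j j.+1.
  by rewrite /wedge; ring.
by rewrite h2 mulr1 addr_gt0 // mulr_gt0.
Qed.

(* In the basis of the two end vectors [C_a], [C_b] the vector [C_j] has
   coordinates [x j], [y j]; the slope [y j / x j] increases from [0] to
   infinity, and unimodularity of consecutive vectors forces it to pass
   through [1]. *)
Lemma wedge_apex (u v : nat -> int) a b :
    (a.+1 < b)%N ->
    (forall j, (a <= j <= b)%N -> 0 < u j) ->
    (forall j, (a <= j < b)%N -> wedge u v j j.+1 = 1) ->
    wedge u v a b = 1 ->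
  exists2 k, (a < k < b)%N & u k = u a + u b /\ v k = v a + v b.
Proof.
move=> ab u0 w1 wab.
pose x j := wedge u v j b; pose y j := wedge u v a j.
(* Cramer's rule in the basis of the end vectors, whose determinant is 1. *)
have coord j : u j = x j * u a + y j * u b /\ v j = x j * v a + y j * v b.
  by rewrite -[u j]mul1r -[v j]mul1r -wab /x /y /wedge; split; ring.
have xgt j : (a <= j < b)%N -> 0 < x j.
  by move=> hj; apply: (wedge_gt0 u0 w1); lia.
have ygt j : (a < j <= b)%N -> 0 < y j.
  by move=> hj; apply: (wedge_gt0 u0 w1); lia.
have xy j : (a <= j < b)%N -> x j * y j.+1 - x j.+1 * y j = 1.
  move=> hj; rewrite -(w1 j hj) -[RHS]mul1r -wab /x /y /wedge; ring.
(* Here [k.+1] is the first index with [x < y]. *)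
have [k [hk yk yk1]] :
    exists k, [/\ (a <= k < b)%N, y k <= x k & x k.+1 < y k.+1].
  have xb : x b = 0 by rewrite /x /wedge; ring.
  have yb : 0 < y b by apply: ygt; lia.
  have ya : y a = 0 by rewrite /y /wedge; ring.
  have xa : 0 < x a by apply: xgt; lia.
  have ex : exists j, (a <= j <= b)%N && (x j < y j).
    by exists b; rewrite xb yb andbT; lia.
  case: (ex_minnP ex) => k /andP[hk hxy] kmin.
  have ak : k != a by apply: contraTneq hxy => ->; rewrite ya -leNgt ltW.
  exists k.-1; rewrite prednK; last by lia.
  split; [by lia | rewrite leNgt | by []].
  by apply/negP => hlt; have := kmin k.-1; rewrite hlt andbT; lia.
have := xy k hk; have := xgt k hk => xk e.
have hxk1 : 0 <= x k.+1.
  case: (ltngtP k.+1 b) => h; [by apply/ltW/xgt; lia | by lia |].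
  by rewrite h /x /wedge subrr.
have hyk : y k = x k.
  (* If [y k < x k], then the determinant in [xy] is at least [x k + x k.+1], so [x k = 1] and
     [x k.+1 = 0]. Then [y k <= 0] forces [k = a], whereas [x a.+1] is positive because
     [a.+1 < b]. *)
  apply/eqP; rewrite eq_le yk leNgt; apply/negP => lt.
  have h1 : 0 <= x k * (y k.+1 - x k.+1 - 1) by rewrite mulr_ge0; lia.
  have h2 : 0 <= x k.+1 * (x k - y k - 1) by rewrite mulr_ge0; lia.
  have [xk1 xk0] : x k = 1 /\ x k.+1 = 0 by split; lia.
  have yk0 : y k <= 0 by lia.
  have ka : k = a.
    apply/eqP; apply/negPn/negP => kna; have := ygt k; lia.
  by have := xgt k.+1; lia.
(* The determinant is now [x k * (y k.+1 - x k.+1) = 1], so [x k] divides 1. *)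
have xk1 : x k = 1 by move: e; rewrite hyk; nia.
have [uk vk] := coord k; rewrite hyk xk1 !mul1r in uk vk.
exists k => //; have kna : k != a.
  by apply/eqP => ka; move: hyk; rewrite xk1 ka /y /wedge subrr.
lia.
Qed.

(** Cutting at the vector [C k = C a + C b] leaves two shorter chains of the same kind, since [det
    (C a, C k) = det (C k, C b) = det (C a, C b) = 1]. *)
Lemma wedge_tree (u v : nat -> int) a b :
    (a < b)%N ->
    (forall j, (a <= j <= b)%N -> 0 < u j) ->
    (forall j, (a <= j < b)%N -> wedge u v j j.+1 = 1) ->
    wedge u v a b = 1 ->
  exists t, [/\ (a + leaves t)%N = b, recurrent (incidence a t) u a b &
               recurrent (incidence a t) v a b].
Proof.
have [d] := ubnP (b - a); elim: d a b => // d IH a b hd ab u0 w1 wab.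
have [abS|abS] := eqVneq b a.+1.
  by exists Leaf; split; [rewrite /=; lia | move=> j; lia | move=> j; lia].
have [|k hk [uk vk]] := @wedge_apex u v a b _ u0 w1 wab; first by lia.
have [|||||l [lk lu lv]] := IH a k; [lia | lia | | | |].
- by move=> j hj; apply: u0; lia.
- by move=> j hj; apply: w1; lia.
- by rewrite -wab /wedge uk vk; ring.
have [|||||r [rb ru rv]] := IH k b; [lia | lia | | | |].
- by move=> j hj; apply: u0; lia.
- by move=> j hj; apply: w1; lia.
- by rewrite -wab /wedge uk vk; ring.
have glue (w : nat -> int) : w k = w a + w b ->
    recurrent (incidence a l) w a k -> recurrent (incidence k r) w k b ->
    recurrent (incidence a (Node l r)) w a b.
  move=> wk wl wr j hj; rewrite /= lk.
  case: (ltngtP j k) => jk.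
  - rewrite (@incidence_out _ r); last by lia.
    by rewrite wl ?inE ?addn0; [congr (_%:R * _); lia | lia].
  - rewrite (@incidence_out _ l); last by lia.
    by rewrite wr ?inE; [congr (_%:R * _); lia | lia].
  (* At the common vertex the two end relations add up, and [w a + w b = w k] supplies the incidence
     of the new triangle. *)
  - rewrite -lk in wl; rewrite -rb in wr.
    have [_] := recurrent_ends wl; have [+ _] := recurrent_ends wr.
    rewrite jk lk rb => -> ->; rewrite !inE eqxx orbT /= !natrD wk.
    by rewrite -/(Posz _); ring.
exists (Node l r); split; first by rewrite /=; lia.
  exact: glue.
exact: glue.
Qed.
End Recurrence.

(** * Triangulations as binary trees *)

Lemma incidence_gt0 a t v :
  1 < leaves t -> a <= v <= a + leaves t -> 0 < incidence a t v.
Proof.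
elim: t a => //= l IHl r IHr a _ hv; rewrite !inE.
have [//|va] := eqVneq v a; have [//|vk] := eqVneq v (a + leaves l).
have [//|vb] := eqVneq v (a + (leaves l + leaves r)); rewrite /= add0n addn_gt0.
have [lt|gt] := ltnP v (a + leaves l); first by rewrite IHl //; lia.
by rewrite IHr ?orbT //; lia.
Qed.

(** One segment per subtree, its root side: leaves give sides of the polygon, inner nodes below the
    root give diagonals. *)
Fixpoint tree_edge (a : nat) (t : bintree) (x y : nat) : bool :=
  ((x == a) && (y == a + leaves t)) ||
  (if t is Node l r then tree_edge a l x y || tree_edge (a + leaves l) r x y
   else false).

Lemma tree_edge_root a t : tree_edge a t a (a + leaves t).
Proof. by case: t => /= *; rewrite !eqxx. Qed.

Lemma tree_edge_bounds a t x y :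
  tree_edge a t x y -> [&& a <= x, x < y & y <= a + leaves t].
Proof.
elim: t a => [|l IHl r IHr] a /=; first by rewrite orbF; lia.
have := leaves_gt0 l; have := leaves_gt0 r => hr hl.
by case/or3P => [|/IHl|/IHr]; lia.
Qed.

(** Segments of different subtrees have ranges that meet in the apex only. *)
Lemma tree_edge_noncrossing a t x y z w :
  tree_edge a t x y -> tree_edge a t z w -> ~~ [&& x < z, z < y & y < w].
Proof.
elim: t a => [|l IHl r IHr] a /=; first by rewrite !orbF; lia.
case/or3P=> [h1|h1|h1] /or3P[h2|h2|h2];
  try (by [exact: IHl h1 h2 | exact: IHr h1 h2]);
  try (move/tree_edge_bounds: h1); try (move/tree_edge_bounds: h2); lia.
Qed.

(** A segment that fits in neither subtree straddles the apex. It then crosses the right side of the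
    root triangle if it starts at [a], and the left side otherwise. *)
Lemma tree_edge_maximal a t x y :
    a <= x -> x < y -> y <= a + leaves t -> ~~ tree_edge a t x y ->
  exists z w, tree_edge a t z w &&
    ([&& x < z, z < y & y < w] || [&& z < x, x < w & w < y]).
Proof.
elim: t a => [|l IHl r IHr] a /=; first by rewrite orbF; lia.
move=> ax xy yb; rewrite !negb_or => /and3P[nab nl nr].
have [yk|ky] := leqP y (a + leaves l).
  have [z [w /andP[h1 h2]]] := IHl a ax xy yk nl.
  by exists z, w; rewrite h1 h2 !orbT.
have [kx|xk] := leqP (a + leaves l) x.
  have [|z [w /andP[h1 h2]]] := IHr (a + leaves l) kx xy _ nr; first by lia.
  by exists z, w; rewrite h1 h2 !orbT.
have [xa|xa] := eqVneq x a.
  exists (a + leaves l), (a + leaves l + leaves r).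
  by rewrite tree_edge_root !orbT /=; move: nab; lia.
exists a, (a + leaves l).
by rewrite tree_edge_root !orbT /=; lia.
Qed.

Section Triangulations.
Variables (n : nat).
Implicit Types (D : {set 'I_n * 'I_n}) (x y z w v : 'I_n).

Definition edge D x y := (x < y) && (is_side (x, y) || ((x, y) \in D)).

Lemma noncrossing_diagonalsP D :
  reflect ({in D, forall d, is_diagonal d} /\
           {in D &, forall d e, ~~ crossing d e})
          (noncrossing_diagonals D).
Proof.
apply: (iffP andP) => -[h1 h2]; split.
- by move=> d dD; apply: (implyP (forallP h1 d)).
- move=> d e dD eD; have /forallP/(_ e) := implyP (forallP h2 d) dD.
  by move/implyP; apply.
- by apply/forallP => d; apply/implyP => dD; apply: h1.
- apply/forallP => d; apply/implyP => dD; apply/forallP => e; apply/implyP => eD.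
  exact: h2.
Qed.

Lemma side_noncrossing (d e : 'I_n * 'I_n) : is_side d -> ~~ crossing d e.
Proof.
case: d e => [x y] [z w]; rewrite /is_side /crossing /=.
have := ltn_ord x; have := ltn_ord y; have := ltn_ord z; have := ltn_ord w; lia.
Qed.

Lemma crossing_sym (d e : 'I_n * 'I_n) : crossing d e = crossing e d.
Proof. by rewrite /crossing orbC. Qed.

Lemma edge_noncrossing D x y z w : noncrossing_diagonals D ->
  edge D x y -> edge D z w -> ~~ [&& x < z, z < y & y < w].
Proof.
move=> /noncrossing_diagonalsP[_ ncD] /andP[_ hxy] /andP[_ hzw].
suff: ~~ crossing (x, y) (z, w) by rewrite negb_or => /andP[].
case/orP: hxy => [/side_noncrossing-> //|hxy].
by case/orP: hzw => [/side_noncrossing|hzw]; [rewrite crossing_sym|exact: ncD].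
Qed.

(** * Counting the triangles inside a sub-polygon *)

Definition triangles_within D (a b : nat) v :=
  [set t in triangles D | (v \in t) && (t \subset [set x : 'I_n | a <= x <= b])].

Lemma in_triangles_within D (a b : nat) v t :
  (t \in triangles_within D a b v) =
  [&& t \in triangles D, v \in t & t \subset [set x : 'I_n | a <= x <= b]].
Proof. by rewrite inE. Qed.

Lemma triangle_edge D t x y :
  t \in triangles D -> x \in t -> y \in t -> x < y -> edge D x y.
Proof.
rewrite inE => /andP[_ /forallP/(_ x)/implyP h] xt yt xy; rewrite /edge xy /=.
by have /forallP/(_ y)/implyP/(_ yt)/implyP/(_ xy) := h xt.
Qed.

Lemma triangle_apexes D x y z :
  edge D x y -> edge D y z -> edge D x z -> [set x; y; z] \in triangles D.
Proof.
move=> /andP[xy exy] /andP[yz eyz] /andP[xz exz]; rewrite inE; apply/andP; split.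
  by rewrite finset.setUC cardsU1 cards2 !inE -!val_eqE /=; lia.
apply/forallP => u; apply/implyP => ut; apply/forallP => w; apply/implyP => wt.
apply/implyP; move: ut wt; rewrite !inE.
case/orP=> [/orP[]|] /eqP-> /orP[/orP[]|] /eqP-> //; lia.
Qed.

(** A triangle in neither half has a vertex [o] before [y] and a vertex [p] after it. An edge from a
    vertex before [y] to [p] must not cross [(x, y)], so that vertex is [x]; symmetrically, every
    vertex after [y] is [z]. *)
Lemma triangle_within_split D t x y z :
    noncrossing_diagonals D -> edge D x y -> edge D y z ->
    t \in triangles D -> t \subset [set u : 'I_n | x <= u <= z] ->
  [\/ t \subset [set u : 'I_n | x <= u <= y],
      t \subset [set u : 'I_n | y <= u <= z] | t = [set x; y; z]].
Proof.
move=> ncD exy eyz tT /fintype.subsetP txz.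
have [sub|/subsetPn[p pt]] := boolP (t \subset [set u : 'I_n | x <= u <= y]).
  by constructor 1.
have [sub|/subsetPn[o ot]] := boolP (t \subset [set u : 'I_n | y <= u <= z]).
  by constructor 2.
have := txz p pt; have := txz o ot; rewrite !inE => ho hp no np.
have inner u : u \in t -> u < y -> u = x.
  move=> ut uy; apply/val_inj => /=; have := txz u ut; rewrite inE.
  have eup : edge D u p by apply: (triangle_edge tT); lia.
  by have := edge_noncrossing ncD exy eup; lia.
have outer u : u \in t -> y < u -> u = z.
  move=> ut yu; apply/val_inj => /=; have := txz u ut; rewrite inE.
  have eou : edge D o u by apply: (triangle_edge tT); lia.
  by have := edge_noncrossing ncD eou eyz; lia.
constructor 3; apply/eqP; rewrite eqEcard; apply/andP; split.
  apply/fintype.subsetP => u ut; rewrite !inE; case: (ltngtP u y) => uy.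
  - by rewrite (inner u) ?eqxx.
  - by rewrite (outer u) ?eqxx ?orbT.
  - by rewrite -(inj_eq val_inj u y) /= uy eqxx orbT.
move: tT; rewrite inE => /andP[/eqP-> _].
by rewrite finset.setUC cardsU1 cards2; lia.
Qed.

Lemma triangles_within_side D (a : nat) v :
  triangles_within D a a.+1 v = finset.set0.
Proof.
apply/setP => t; rewrite in_triangles_within finset.in_set0; apply/negP.
case/and3P; rewrite inE => /andP[/eqP t3 _] _ sub.
have := subset_leq_card sub; rewrite t3 leqNgt => /negP; apply.
(* The bounds are bare naturals, so [a] or [a.+1] may fail to be a vertex. *)
have [a1n|a1n] := ltnP a.+1 n; last first.
  have [an|an] := ltnP a n; last first.
    rewrite (_ : [set _ | _] = finset.set0) ?cards0 //.
    by apply/setP => u; rewrite !inE; have := ltn_ord u; lia.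
  apply: leq_ltn_trans (subset_leq_card (_ : _ \subset [set Ordinal an])) _.
    apply/fintype.subsetP => u; rewrite !inE -val_eqE /=; have := ltn_ord u; lia.
  by rewrite cards1.
have an : a < n by lia.
apply: leq_ltn_trans
  (subset_leq_card (_ : _ \subset [set Ordinal an; Ordinal a1n])) _.
  by apply/fintype.subsetP => u; rewrite !inE -!val_eqE /=; lia.
by rewrite cards2; case: eqP.
Qed.

(** The triangles between [x] and [z] fall into three disjoint families: those left of [y], those
    right of [y], and the triangle [x, y, z] itself. *)
Lemma card_triangles_within_split D x y z v :
    noncrossing_diagonals D -> edge D x y -> edge D y z -> edge D x z ->
  #|triangles_within D x z v| = (val v \in [:: val x; val y; val z])
    + (#|triangles_within D x y v| + #|triangles_within D y z v|).
Proof.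
move=> ncD exy eyz exz.
have [xy yz] : x < y /\ y < z by case/andP: exy; case/andP: eyz.
have xyzT := triangle_apexes exy eyz exz.
(* Filtering a singleton makes the cardinal of [apex] the indicator of [v] being one of the three
   vertices. *)
pose apex := [set t in [set [set x; y; z]] | v \in t].
have inapex t : (t \in apex) = (t == [set x; y; z]) && (v \in t).
  by rewrite inE finset.in_set1.
have -> : triangles_within D x z v
    = apex :|: (triangles_within D x y v :|: triangles_within D y z v).
  apply/setP => t; rewrite !finset.in_setU inapex !in_triangles_within.
  apply/idP/idP.
    case/andP=> tT /andP[vt sub].
    have [sub'|sub'|e] := triangle_within_split ncD exy eyz tT sub.
    - by rewrite tT vt sub' orbT.
    - by rewrite tT vt sub' !orbT.
    - by rewrite -e eqxx vt.
  case/or3P.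
  - case/andP=> /eqP-> vt; rewrite xyzT vt /=.
    by apply/fintype.subsetP => u; rewrite !inE => /orP[/orP[]|] /eqP->; lia.
  - case/and3P=> -> -> /fintype.subsetP sub; apply/fintype.subsetP => u /sub.
    by rewrite !inE; lia.
  - case/and3P=> -> -> /fintype.subsetP sub; apply/fintype.subsetP => u /sub.
    by rewrite !inE; lia.
rewrite cardsU (_ : apex :&: _ = finset.set0) ?cards0 ?subn0; last first.
  apply/setP => t; rewrite finset.in_setI inapex finset.in_setU.
  rewrite !in_triangles_within finset.in_set0; apply/negP.
  case/andP=> /andP[/eqP-> _].
  case/orP=> /and3P[_ _ /fintype.subsetP sub].
    by have := sub z; rewrite !inE eqxx !orbT => /(_ isT); lia.
  by have := sub x; rewrite !inE eqxx => /(_ isT); lia.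
rewrite cardsU (_ : _ :&: triangles_within D y z v = finset.set0); last first.
  apply/setP => t; rewrite finset.in_setI !in_triangles_within finset.in_set0.
  apply/negP => /andP[/and3P[]]; rewrite inE.
  move=> /andP[/eqP t3 _] _ /fintype.subsetP s1.
  case/and3P=> _ _ /fintype.subsetP s2.
  have : t \subset [set y].
    apply/fintype.subsetP => u ut; have := s1 u ut; have := s2 u ut.
    by rewrite !inE -val_eqE /=; lia.
  by move/subset_leq_card; rewrite t3 cards1.
rewrite cards0 subn0; congr addn.
rewrite !inE !val_eqE.
have [vxyz|vxyz] := boolP [|| v == x, v == y | v == z].
  rewrite /= -(cards1 [set x; y; z]); apply: eq_card => t.
  rewrite inapex finset.in_set1.
  by case: eqP => // ->; rewrite !inE -orbA vxyz.
apply: eq_card0 => t; rewrite inapex; apply/negP => /andP[/eqP->].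
by rewrite !inE -orbA (negbTE vxyz).
Qed.

(** The splitting identity has the shape of the recursion of [incidence], each node providing the
    three edges it asks for. *)
Lemma card_triangles_within_tree D t (x z v : 'I_n) :
    noncrossing_diagonals D -> x + leaves t = z ->
    (forall u w : 'I_n, tree_edge x t u w -> edge D u w) ->
  #|triangles_within D x z v| = incidence x t v.
Proof.
move=> ncD; elim: t x z => [|l IHl r IHr] x z /= xz edges.
  by rewrite -xz addn1 triangles_within_side cards0.
have hl := leaves_gt0 l; have hr := leaves_gt0 r.
have yn : x + leaves l < n by have := ltn_ord z; lia.
pose y := Ordinal yn.
have edl (u w : 'I_n) : tree_edge x l u w -> edge D u w.
  by move=> h; apply: edges; rewrite h orbT.
have edr (u w : 'I_n) : tree_edge y r u w -> edge D u w.
  by move=> h; apply: edges; rewrite h !orbT.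
have yz : y + leaves r = z by rewrite /= -xz addnA.
rewrite (@card_triangles_within_split _ _ y) //.
- by rewrite (IHl x y) // (IHr y z) // xz.
- by apply: edl; apply: tree_edge_root.
- by apply: edr; rewrite -yz tree_edge_root.
- by apply: edges; rewrite eqxx xz eqxx.
Qed.

(** * From a triangulation to a tree *)

Lemma triangulation_maximal D x y : triangulation D -> x < y -> ~~ edge D x y ->
  exists z w, edge D z w &&
    ([&& x < z, z < y & y < w] || [&& z < x, x < w & w < y]).
Proof.
move=> /maxsetP[/noncrossing_diagonalsP[diagD ncD] maxD] xy.
rewrite /edge xy /= negb_or => /andP[nside nD].
have diag_xy : is_diagonal (x, y) by rewrite /is_diagonal xy.
(* Otherwise [(x, y)] could be added to [D], against maximality. *)
have /existsP[[z w] /andP[zwD cr]] : [exists e in D, crossing (x, y) e].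
  apply: contraT => nex.
  have ncxy e : e \in D -> ~~ crossing (x, y) e.
    move=> eD; apply: contra nex => cr; apply/existsP; exists e.
    by rewrite eD.
  suff /maxD/(_ (finset.subsetUr _ _)) e : noncrossing_diagonals ((x, y) |: D).
    by rewrite -e !inE eqxx in nD.
  apply/noncrossing_diagonalsP; split=> [d|d e].
    by rewrite !inE => /predU1P[-> //|/diagD].
  rewrite !inE => /predU1P[->|dD] /predU1P[->|eD].
  - by rewrite /crossing /= !ltnn.
  - exact: ncxy.
  - by rewrite crossing_sym ncxy.
  - exact: ncD.
exists z, w; move: cr; rewrite /crossing /= => cr.
by rewrite zwD orbT andbT cr andbT; case/andP: (diagD _ zwD).
Qed.

(** Take the last [y] before [z] joined to [x]. If [(y, z)] were not an edge, some edge would cross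
    it; that edge either crosses [(x, z)] or [(x, y)], or joins [x] to a vertex between [y] and
    [z]. *)
Lemma triangulation_apex D x z : triangulation D -> edge D x z -> x.+1 < z ->
  exists y : 'I_n, edge D x y && edge D y z.
Proof.
move=> trD exz xz; have ncD := maxsetp trD.
have sn : x.+1 < n by have := ltn_ord z; lia.
pose s := Ordinal sn.
have ex : edge D x s && (s < z) by rewrite /edge /is_side /= eqxx ltnSn.
pose P := [pred y : 'I_n | edge D x y && (y < z)].
case: (@arg_maxnP _ s P (fun y => y : nat) ex) => y /andP[exy yz] ymax.
exists y; rewrite exy /=; apply: contraT => nyz.
have [u [w /andP[euw]]] := triangulation_maximal trD yz nyz.
have xy : x < y by case/andP: exy.
case/orP => h; first by have := edge_noncrossing ncD exz euw; lia.
have [ux|ux] := eqVneq u x.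
  have := ymax w; rewrite /P inE -ux euw => /(_ _); lia.
have := edge_noncrossing ncD euw exz; have := edge_noncrossing ncD exy euw.
by move: ux; rewrite -val_eqE /=; lia.
Qed.

Lemma triangulation_tree D x z : triangulation D -> edge D x z ->
  exists2 t, x + leaves t = z &
    forall u w : 'I_n, tree_edge x t u w -> edge D u w.
Proof.
move=> trD; have [d] := ubnP (z - x); elim: d x z => // d IH x z hd exz.
have xz : x < z by case/andP: exz.
have [zx|zx] := eqVneq (z : nat) x.+1.
  exists Leaf => [|u w /=]; first by rewrite /= zx addn1.
  by rewrite orbF addn1 -zx => /andP[/eqP/val_inj-> /eqP/val_inj->].
have [|y /andP[exy eyz]] := triangulation_apex trD exz; first by lia.
have [xy yz] : x < y /\ y < z by case/andP: exy; case/andP: eyz.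
have [||l lE ledge] := IH x y => //; first by lia.
have [||r rE redge] := IH y z => //; first by lia.
exists (Node l r) => [|u w /=]; first by rewrite /= addnA lE.
rewrite addnA lE rE => /or3P[/andP[/eqP/val_inj-> /eqP/val_inj->] //| |].
  exact: ledge.
exact: redge.
Qed.

(** * From a tree to a triangulation *)

Definition tree_diagonals t : {set 'I_n * 'I_n} :=
  [set e | is_diagonal e && tree_edge 0 t e.1 e.2].

Lemma edge_tree_diagonals t (x y : 'I_n) :
  tree_edge 0 t x y -> edge (tree_diagonals t) x y.
Proof.
move=> h; have /and3P[_ xy _] := tree_edge_bounds h.
by rewrite /edge xy inE /is_diagonal xy h andbT orbN.
Qed.

Lemma tree_diagonals_noncrossing t : noncrossing_diagonals (tree_diagonals t).
Proof.
apply/noncrossing_diagonalsP; split=> [d|d e]; first by rewrite inE => /andP[].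
rewrite !inE => /andP[_ hd] /andP[_ he]; rewrite negb_or.
by rewrite (tree_edge_noncrossing hd he) (tree_edge_noncrossing he hd).
Qed.

(** A further diagonal would cross a segment of the tree, which is either a side, crossed by
    nothing, or already a diagonal of the larger set. *)
Lemma tree_triangulation t : (leaves t).+1 = n -> triangulation (tree_diagonals t).
Proof.
move=> tn; apply/maxsetP; split=> [|B ncB sub].
  exact: tree_diagonals_noncrossing.
apply/eqP; rewrite finset.eqEsubset sub andbT; apply/fintype.subsetP => -[x y] xyB.
have /noncrossing_diagonalsP[diagB {}ncB] := ncB.
have diag := diagB _ xyB; rewrite inE diag /=; apply: contraT => nxy.
have xy : x < y by case/andP: diag.
have [||z [w /andP[ezw cr]]] := tree_edge_maximal _ xy _ nxy => //.
  by have := ltn_ord y; lia.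
have /and3P[_ zw wt] := tree_edge_bounds ezw.
have wn : w < n by lia.
have zn : z < n by lia.
have {}cr : crossing (x, y) (Ordinal zn, Ordinal wn) by [].
have /andP[_ /orP[side|zwD]] := @edge_tree_diagonals t (Ordinal zn) (Ordinal wn) ezw.
  by have := side_noncrossing (x, y) side; rewrite crossing_sym cr.
by have := ncB _ _ xyB (fintype.subsetP sub _ zwD); rewrite cr.
Qed.

Lemma triangles_at_tree D t v :
    noncrossing_diagonals D -> (leaves t).+1 = n ->
    (forall u w : 'I_n, tree_edge 0 t u w -> edge D u w) ->
  triangles_at D v = incidence 0 t v.
Proof.
move=> ncD tn edges.
have n0 : 0 < n by lia.
have tlt : leaves t < n by lia.
rewrite -(@card_triangles_within_tree D t (Ordinal n0) (Ordinal tlt)) //.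
apply: eq_card => s; rewrite in_triangles_within finset.in_set.
rewrite (_ : s \subset _) ?andbT //.
apply/fintype.subsetP => u _; rewrite inE /=; have := ltn_ord u; lia.
Qed.

(** The tree is rooted at the side [(0, n - 1)]; [Leaf] accounts for the degenerate quiddity of
    order 2. *)
Lemma quiddityP (q : n.-tuple nat) : 2 <= n ->
  quiddity q <->
  exists2 t, (leaves t).+1 = n & forall i, tnth q i = incidence 0 t i.
Proof.
move=> n2; split.
  case=> [[e q0]|[n3 _ [D trD qD]]].
    by exists Leaf => [|i]; rewrite ?q0 // e.
  have n0 : 0 < n by lia.
  have n1 : n.-1 < n by lia.
  have eroot : edge D (Ordinal n0) (Ordinal n1).
    by rewrite /edge /is_side /= prednK // eqxx; lia.
  have [t tE edges] := triangulation_tree trD eroot.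
  have tn : (leaves t).+1 = n by rewrite /= in tE; lia.
  exists t => // i; rewrite qD; apply: triangles_at_tree => //.
  exact: maxsetp trD.
case=> t tn qt; have [e|n2'] := eqVneq n 2.
  left; split=> // i; rewrite qt; case: t tn {qt} => //= l r.
  by have := leaves_gt0 l; have := leaves_gt0 r; lia.
right; split; first by lia.
  by move=> i; rewrite qt incidence_gt0 //; have := ltn_ord i; lia.
exists (tree_diagonals t); first exact: tree_triangulation.
move=> i; rewrite qt; symmetry; apply: triangles_at_tree => //.
  exact: tree_diagonals_noncrossing.
exact: edge_tree_diagonals.
Qed.
End Triangulations.

(** * Toric tilings *)

Local Open Scope ring_scope.

Lemma int_shift_ind (P : int -> Prop) :
    P 0 -> (forall j, P j -> P (j + 1)) -> (forall j, P j -> P (j - 1)) ->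
  forall j, P j.
Proof.
move=> P0 PD PB; elim/int_ind=> // k Pk; first by rewrite -addn1 PoszD; apply: PD.
by rewrite -addn1 PoszD opprD; apply: PB.
Qed.

Lemma int_mod_ind (n : nat) (P : int -> Prop) :
    (0 < n)%N -> (forall j, P j <-> P (j + n%:Z)) ->
    (forall j : nat, (j < n)%N -> P j%:Z) ->
  forall j, P j.
Proof.
move=> n0 Pper P0 j; rewrite (divz_eq j n%:Z).
have : 0 <= (j %% n)%Z < n%:Z by rewrite modz_ge0 ?ltz_pmod //; lia.
case: (j %% n)%Z => // r /andP[_ hr]; elim/int_shift_ind: (j %/ n)%Z.
- by rewrite mul0r add0r; apply: P0.
- move=> k /Pper; rewrite (_ : k * _ + _ + _ = (k + 1) * n%:Z + r) //; ring.
- move=> k Pk; apply/Pper.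
  by rewrite (_ : (k - 1) * _ + _ + _ = k * n%:Z + r) //; ring.
Qed.

Section PeriodicExtension.
Variables (n : nat) (q : n.-tuple nat).

Lemma perext_nat (j : nat) : (j < n)%N -> perext q j%:Z = nth 0%N q j.
Proof. by move=> jn; rewrite /perext modz_small //; lia. Qed.

Lemma perext_tnth (j : 'I_n) : perext q (j : nat)%:Z = tnth q j.
Proof. by rewrite perext_nat // (tnth_nth 0%N). Qed.

Lemma perext_period j : perext q (j + n%:Z) = perext q j.
Proof. by rewrite /perext modzDr. Qed.
End PeriodicExtension.

(** * Two-sided recurrences over the integers *)

Section IntRecurrence.
Variable R : realType.
Implicit Types (q : int -> nat) (V W : int -> R).

Definition int_recurrent q V :=
  forall j, V (j + 1) = (q j)%:R * V j - V (j - 1).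

Lemma int_recurrent_eq q V W :
  int_recurrent q V -> int_recurrent q W -> V 0 = W 0 -> V 1 = W 1 -> V =1 W.
Proof.
move=> rV rW e0 e1 j; suff [] : V j = W j /\ V (j + 1) = W (j + 1) by [].
elim/int_shift_ind: j => [|j [ej ejS]|j [ej ejS]]; first by rewrite add0r.
  by split=> //; rewrite rV rW addrK ej ejS.
rewrite subrK; split=> //.
by have := rV j; rewrite ejS rW ej => /addrI/oppr_inj.
Qed.

(** Carries the pair [(V k, V (k + 1))]. *)
Fixpoint forward q (x y : R) (k : nat) : R * R :=
  if k is k'.+1 then
    let p := forward q x y k' in (p.2, (q k%:Z)%:R * p.2 - p.1)
  else (x, y).

(** Carries the pair [(V (- k), V (- k + 1))]. *)
Fixpoint backward q (x y : R) (k : nat) : R * R :=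
  if k is k'.+1 then
    let p := backward q x y k' in ((q (- k'%:Z))%:R * p.1 - p.2, p.1)
  else (x, y).

Lemma int_recurrent_exists q (x y : R) :
  exists V, [/\ int_recurrent q V, V 0 = x & V 1 = y].
Proof.
exists (fun j => match j with
  | Posz k => (forward q x y k).1 | Negz k => (backward q x y k.+1).1 end).
split=> // -[[|k]|k].
- by rewrite add0r sub0r /= oppr0; ring.
- have -> : k.+1%:Z + 1 = k.+2 by lia.
  by have -> : k.+1%:Z - 1 = k by lia.
- have -> : Negz k - 1 = Negz k.+1 by lia.
  case: k => [|k].
    by rewrite (_ : Negz 0 + 1 = 0) //=; ring.
  have -> : Negz k.+1 + 1 = Negz k by lia.
  by rewrite /= NegzE; ring.
Qed.

Lemma int_recurrent_int q V : int_recurrent q V ->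
  V 0 \is a Num.int -> V 1 \is a Num.int -> forall j, V j \is a Num.int.
Proof.
move=> rV i0 i1 j.
suff [] : V j \is a Num.int /\ V (j + 1) \is a Num.int by [].
elim/int_shift_ind: j => [|j [ij ijS]|j [ij ijS]]; first by rewrite add0r.
  by split=> //; rewrite rV addrK rpredB ?rpredM ?rpred_nat.
rewrite subrK; split=> //.
have -> : V (j - 1) = (q j)%:R * V j - V (j + 1) by rewrite rV; ring.
by rewrite rpredB ?rpredM ?rpred_nat.
Qed.

Section Quiddity.
Variables (n : nat) (q : n.-tuple nat) (V : int -> R).
Hypotheses (n2 : (2 <= n)%N) (quid : quiddity q).
Hypothesis rV : int_recurrent (perext q) V.

Lemma quiddity_tree : exists t, [/\ (leaves t).+1 = n,
  forall j : nat, (j < n)%N -> perext q j%:Z = incidence 0 t j &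
  recurrent (incidence 0 t) (fun j => V j%:Z) 0 (leaves t)].
Proof.
have [t tn qt] := (quiddityP q n2).1 quid; exists t.
have qE j : (j < n)%N -> perext q j%:Z = incidence 0 t j.
  by move=> jn; rewrite -(qt (Ordinal jn)) -perext_tnth.
split=> // j hj; rewrite -qE; last by lia.
have -> : j.+1%:Z = j%:Z + 1 by lia.
have -> : j.-1%:Z = j%:Z - 1 by lia.
by rewrite rV subrK.
Qed.

(** Compare the end relations of the tree with the two-sided recurrence at [0] and at [n - 1]. *)
Lemma quiddity_root : V (n.-1%:Z) = - V (-1) /\ V n%:Z = - V 0.
Proof.
have [t [tn qE /recurrent_ends/=]] := quiddity_tree; rewrite !add0n => -[e0 e1].
have n0 : (0 < n)%N by lia.
have tE : leaves t = n.-1 by rewrite -tn.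
split.
  have := rV 0; rewrite add0r sub0r (qE 0%N) // (e0 : V 1 = _) tE; lra.
have := rV n.-1%:Z; rewrite (_ : n.-1%:Z + 1 = n); last by lia.
rewrite (_ : n.-1%:Z - 1 = n.-2); last by lia.
by rewrite qE -?tE ?e1; [lra | lia].
Qed.

(** The sequence [- V (j + n)] satisfies the same recurrence, as [q] is periodic, and agrees with
    [V] at [0] and [1]. *)
Lemma quiddity_antiperiodic j : V (j + n%:Z) = - V j.
Proof.
have [e0 e1] := quiddity_root.
apply/esym/oppr_inj; rewrite opprK.
have rV' : int_recurrent (perext q) (fun j => - V (j + n%:Z)).
  move=> i; rewrite -(perext_period q i) addrAC rV (addrAC _ _ (-1)); ring.
apply: (int_recurrent_eq rV rV'); first by rewrite add0r e1 opprK.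
have := rV 0; have := rV' 0; rewrite add0r => -> ->.
rewrite !add0r e1 opprK; congr (_ - _).
by rewrite (_ : -1 + n%:Z = n.-1) ?e0 ?opprK //; lia.
Qed.

(** Since [V (n - 1) = - V (-1)], both ends of the root side carry positive values. *)
Lemma quiddity_gt0 : V (-1) < 0 -> 0 < V 0 ->
  forall j : nat, (j < n)%N -> 0 < V j%:Z.
Proof.
move=> Vm V0 j jn; have [t [tn qE rt]] := quiddity_tree.
have [e0 _] := quiddity_root.
apply: (recurrent_gt0 rt V0) => /=; last by lia.
by rewrite add0n (_ : leaves t = n.-1) ?e0 ?oppr_gt0 // -tn.
Qed.
End Quiddity.
End IntRecurrence.

(** * Passing between tilings and triples *)

Section Tilings.
Variable R : realType.

Lemma toric_tiling_tr n m (a : int -> int -> R) :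
  toric_tiling n m a -> toric_tiling m n (fun i j => a j i).
Proof.
move=> [det pn pm pos]; split=> // i j; last by move=> hi hj; apply: pos.
by rewrite -(det j i) (mulrC (a (j + 1) i)).
Qed.

Lemma toric_tiling_neq0 n m (a : int -> int -> R) :
    (0 < n)%N -> (0 < m)%N -> toric_tiling n m a ->
  forall i j, a i j != 0.
Proof.
move=> n0 m0 [_ pn pm pos]; apply: (int_mod_ind m0) => [i|i im].
  by split=> h j; move: (h j); rewrite pm oppr_eq0.
apply: (int_mod_ind n0) => [j|j jn]; first by rewrite pn oppr_eq0.
have [//||h _] := pos i j; [lia | lia |].
by rewrite gt_eqF.
Qed.

Lemma tiling_quiddity n m (a : int -> int -> R) :
    (2 <= n)%N -> (2 <= m)%N -> toric_tiling n m a ->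
  exists2 q : n.-tuple nat, quiddity q &
    forall i, int_recurrent (perext q) (a i).
Proof.
move=> n2 m2 ta; have [det pn pm pos] := ta.
have n0 : (0 < n)%N by lia.
have m0 : (0 < m)%N by lia.
have a0 := toric_tiling_neq0 n0 m0 ta.
(* The chain argument needs integers: on the fundamental rectangle, taking floors loses nothing. *)
pose u (i : nat) (j : nat) := Num.floor (a i j).
have uE i j : (i < 2)%N -> (j < n)%N -> (u i j)%:~R = a i j.
  by move=> i2 jn; rewrite floorK //; have [|| //] := pos i j; lia.
have ugt0 j : (0 <= j <= n.-1)%N -> 0 < u 0%N j.
  move=> jn; rewrite -(ltr0z R) uE //; last by lia.
  by have [|| //] := pos 0 j; lia.
have w1 j : (0 <= j < n.-1)%N -> wedge (u 0%N) (u 1%N) j j.+1 = 1.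
  move=> jn; apply: (@intr_inj R); rewrite rmorphB !rmorphM /= !uE; try by lia.
  have := det 0 j; rewrite add0r (_ : j%:Z + 1 = j.+1); last by lia.
  exact.
(* This is the determinant at columns [n - 1] and [n], with column [n] replaced by minus column
   [0]. *)
have wab : wedge (u 0%N) (u 1%N) 0 n.-1 = 1.
  apply: (@intr_inj R); rewrite rmorphB !rmorphM /= !uE; try by lia.
  have := det 0 n.-1; rewrite (_ : n.-1%:Z + 1 = 0 + n%:Z); last by lia.
  by rewrite !pn add0r; lra.
have [|t [tn r0 _]] := wedge_tree _ ugt0 w1 wab; first by lia.
rewrite add0n in tn.
pose q := [tuple incidence 0 t i | i < n].
have qE j : (j < n)%N -> perext q j%:Z = incidence 0 t j.
  by move=> jn; rewrite (perext_tnth q (Ordinal jn)) tnth_mktuple.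
exists q; first by apply/quiddityP => //; exists t => [|i];
  [rewrite tn prednK | rewrite tnth_mktuple].
have ra : recurrent (incidence 0 t) (fun j : nat => a 0 j) 0 (0 + leaves t).
  move=> j hj; have := congr1 (fun z : int => z%:~R : R) (r0 j _).
  rewrite rmorphD rmorphM /= !uE ?mulrz_nat; try by lia.
  by rewrite pmulrn; apply; lia.
have [e0 e1] := recurrent_ends ra; rewrite /= add0n tn in e0 e1.
(* Inside one period this is [ra]; at [0] and [n - 1] it is an end relation combined with
   antiperiodicity. *)
have row0 : int_recurrent (perext q) (a 0).
  apply: (int_mod_ind n0) => [j|j jn].
    rewrite perext_period -addrA (addrC n%:Z) addrA pn.
    rewrite -(addrA j n%:Z) (addrC n%:Z) addrA !pn.
    by split=> h; lra.
  rewrite qE //.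
  have [->|j0] := eqVneq j 0%N.
    rewrite add0r e0 sub0r -[a 0 (-1)]opprK -pn.
    by rewrite (_ : -1 + n%:Z = n.-1) ?opprK //; lia.
  have [->|jn1] := eqVneq j n.-1.
    rewrite (_ : n.-1%:Z + 1 = 0 + n%:Z); last by lia.
    rewrite pn (_ : n.-1%:Z - 1 = n.-2); last by lia.
    by rewrite e1; lra.
  have := ra j; rewrite add0n tn => /(_ _) <-; last by lia.
  have -> : j.+1%:Z = j%:Z + 1 by lia.
  by rewrite (_ : j.-1%:Z = j%:Z - 1) ?addrK //; lia.
(* Two consecutive columns of consecutive rows have determinant 1, so the
   coefficient of the recurrence is the same in every row. *)
elim/int_shift_ind => [|i IH|i IH] // j.
  apply: (mulfI (a0 i j)).
  have := det i (j - 1); have := det i j; rewrite subrK IH; lra.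
apply: (mulfI (a0 i j)).
have := det (i - 1) (j - 1); have := det (i - 1) j; rewrite !subrK IH; lra.
Qed.

Lemma corresponds_entries n m (t : triple n m) (a : int -> int -> R) :
  corresponds t a -> let M := t.2 in
  [/\ a 0 0 = (M 0 0)%:~R, a 0 1 = (M 0 1)%:~R, a 1 0 = (M 1 0)%:~R &
      a 1 1 = (M 1 1)%:~R].
Proof.
case: t => -[q q'] M [_ _ eM] /=.
have e k l : a (k : 'I_2)%:Z (l : 'I_2)%:Z = (M k l)%:~R.
  by have := congr1 (fun A : 'M_2 => A k l) eM; rewrite !mxE.
by split; [exact: (e 0 0) | exact: (e 0 1) | exact: (e 1 0) | exact: (e 1 1)].
Qed.

(** Columns [0] and [1] are generated from [M] by [q'], and then every row from its first two
    entries by [q]. *)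
Lemma corresponds_exists n m (t : triple n m) :
  exists a : int -> int -> R, corresponds t a.
Proof.
case: t => -[q q'] M.
have [C0 [rC0 C00 C01]] := int_recurrent_exists (perext q')
  ((M 0 0)%:~R : R) ((M 1 0)%:~R).
have [C1 [rC1 C10 C11]] := int_recurrent_exists (perext q')
  ((M 0 1)%:~R : R) ((M 1 1)%:~R).
have /choice[a aP] i := int_recurrent_exists (perext q) (C0 i) (C1 i).
have ra i : int_recurrent (perext q) (a i) by have [] := aP i.
have a0 i : a i 0 = C0 i by have [] := aP i.
have a1 i : a i 1 = C1 i by have [] := aP i.
exists a; split=> [i|i|]; first exact: ra.
  (* The vertical recurrence compares two solutions of the row recurrence that agree in columns [0]
     and [1]. *)
  have r' : int_recurrent (perext q)
      (fun j => (perext q' i)%:R * a i j - a (i - 1) j).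
    by move=> j; rewrite !ra; ring.
  by apply: int_recurrent_eq (ra _) r' _ _; rewrite ?a0 ?a1 ?rC0 ?rC1.
apply/matrixP => k l; rewrite !mxE.
by case: k l => -[|[|//]] hk [[|[|//]] hl]; rewrite ?a0 ?a1 ?C00 ?C01 ?C10 ?C11;
  congr (M _ _)%:~R; apply/val_inj.
Qed.

Lemma corresponds_unique n m (t : triple n m) (a a' : int -> int -> R) :
  corresponds t a -> corresponds t a' -> a = a'.
Proof.
move=> ca ca'.
have [/= e00 e01 e10 e11] := corresponds_entries ca.
have [/= f00 f01 f10 f11] := corresponds_entries ca'.
case: t ca ca' e00 e01 e10 e11 f00 f01 f10 f11 => -[q q'] M.
move=> [r1 r2 _] [r1' r2' _] /= e00 e01 e10 e11 f00 f01 f10 f11.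
apply/funext => i; apply/funext => j.
apply: (int_recurrent_eq (r1 i) (r1' i)).
  apply: (int_recurrent_eq (q := perext q') (V := a^~ 0) (W := a'^~ 0)).
  - by move=> k; apply: r2.
  - by move=> k; apply: r2'.
  - by rewrite e00 f00.
  - by rewrite e10 f10.
apply: (int_recurrent_eq (q := perext q') (V := a^~ 1) (W := a'^~ 1)).
- by move=> k; apply: r2.
- by move=> k; apply: r2'.
- by rewrite e01 f01.
- by rewrite e11 f11.
Qed.

(** A step of either recurrence multiplies the 2 by 2 block by a matrix of determinant 1. *)
Lemma corresponds_det n m (t : triple n m) (a : int -> int -> R) :
    corresponds t a -> t.2 0 0 * t.2 1 1 - t.2 0 1 * t.2 1 0 = 1 ->
  forall i j, a i j * a (i + 1) (j + 1) - a i (j + 1) * a (i + 1) j = 1.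
Proof.
move=> ca; have [] := corresponds_entries ca.
case: t ca => -[q q'] M [r1 r2 _] /= e00 e01 e10 e11 detM.
elim/int_shift_ind=> [|i IH|i IH] j; first 1 last.
- by rewrite -(IH j) !(r2 (i + 1)) !addrK; ring.
- by rewrite -(IH j) subrK !(r2 i); ring.
rewrite add0r; elim/int_shift_ind: j => [|j IH|j IH].
- rewrite add0r e00 e01 e10 e11 -!rmorphM -rmorphB /=.
  by rewrite detM.
- by rewrite -IH (r1 0 (j + 1)) (r1 1 (j + 1)) !addrK; ring.
- by rewrite -IH subrK (r1 0 j) (r1 1 j); ring.
Qed.

Lemma corresponds_int n m (t : triple n m) (a : int -> int -> R) :
  corresponds t a -> forall i j, a i j \is a Num.int.
Proof.
move=> ca; have [] := corresponds_entries ca.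
case: t ca => -[q q'] M [r1 r2 _] /= e00 e01 e10 e11 i j.
have c0 : int_recurrent (perext q') (a^~ 0) by move=> k; apply: r2.
have c1 : int_recurrent (perext q') (a^~ 1) by move=> k; apply: r2.
apply: (int_recurrent_int (r1 i)).
  by apply: (int_recurrent_int c0); rewrite ?e00 ?e10 ?intr_int.
by apply: (int_recurrent_int c1); rewrite ?e01 ?e11 ?intr_int.
Qed.

(** Positivity spreads from the corner: first along row [0], which makes row [-1] negative, and then
    down each column. *)
Lemma corresponds_toric n m (t : triple n m) (a : int -> int -> R) :
    (2 <= n)%N -> (2 <= m)%N -> admissible t -> corresponds t a ->
  toric_tiling n m a.
Proof.
move=> n2 m2; case: t => -[q q'] M [hq hq' [Mpos detM] ltq ltq'] ca.
have det := corresponds_det ca detM; have aint := corresponds_int ca.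
have [/= e00 e01 e10 e11] := corresponds_entries ca.
have [r1 r2 _] := ca.
have rc j : int_recurrent (perext q') (a^~ j) by move=> k; apply: r2.
split=> // [i j|i j|]; first exact: quiddity_antiperiodic hq (r1 i) j.
  exact: quiddity_antiperiodic hq' (rc j) i.
have M00 := Mpos 0 0.
have p00 : 0 < a 0 0 by rewrite e00 ltr0z.
have p10 : 0 < a 1 0 by rewrite e10 ltr0z.
(* After multiplication by [a 0 0], this is the inequality on [q] at [0]. *)
have row0m : a 0 (-1) < 0.
  have := r1 0 0; rewrite add0r sub0r => e.
  have -> : a 0 (-1) = (perext q 0)%:R * a 0 0 - a 0 1 by rewrite e; ring.
  move: ltq; rewrite ltr_pdivlMr ?ltr0z // e00 e01 subr_lt0.
  by rewrite pmulrn -intrM ltr_int pmulrn -intrM ltr_int.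
have col0m : a (-1) 0 < 0.
  have := r2 0 0; rewrite add0r sub0r => e.
  have -> : a (-1) 0 = (perext q' 0)%:R * a 0 0 - a 1 0 by rewrite e; ring.
  move: ltq'; rewrite ltr_pdivlMr ?ltr0z // e00 e10 subr_lt0.
  by rewrite pmulrn -intrM ltr_int pmulrn -intrM ltr_int.
have row1m : a 1 (-1) < 0.
  rewrite -(pmulr_rlt0 _ p00); have := det 0 (-1).
  rewrite add0r addNr => d.
  have -> : a 0 0 * a 1 (-1) = a 0 (-1) * a 1 0 - 1 by lra.
  by rewrite subr_lt0 (lt_trans _ ltr01) // nmulr_rlt0.
have row0 := quiddity_gt0 n2 hq (r1 0) row0m p00.
(* The determinant of rows [-1] and [0] carries the negative sign from column [j] to column
   [j + 1]. *)
have colm (j : nat) : (j < n)%N -> a (-1) j < 0.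
  elim: j => // j IHj jn; have aj : 0 < a 0 j by apply: row0; lia.
  rewrite -(pmulr_rlt0 _ aj); have := det (-1) j.
  rewrite addNr -addn1 PoszD => d.
  have -> : a 0 j * a (-1) (j%:Z + 1) = a (-1) j * a 0 (j%:Z + 1) - 1 by lra.
  rewrite subr_lt0 (lt_trans _ ltr01) // nmulr_rlt0 ?IHj //; last by lia.
  by have := row0 j.+1 jn; rewrite -addn1 PoszD.
move=> [i|i] [j|j] hi hj; try by lia.
split; last exact: aint.
apply: (quiddity_gt0 m2 hq' (rc j)); [apply: colm | apply: row0 | ]; lia.
Qed.

(** The coefficients are recovered by cancelling the nonzero entries of row [0] and column [0]. *)
Lemma corresponds_inj n m (t t' : triple n m) (a : int -> int -> R) :
    (forall i j, a i j != 0) -> corresponds t a -> corresponds t' a -> t = t'.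
Proof.
move=> a0; case: t => -[q q'] M; case: t' => -[p p'] N.
move=> [r1 r2 eM] [s1 s2 eN]; congr (_, _, _).
- apply/eq_from_tnth => j; rewrite -!perext_tnth; apply/eqP.
  rewrite -(eqr_nat R); apply/eqP/(mulIf (a0 0 j)).
  by have := s1 0 j; rewrite r1 => /addIr.
- apply/eq_from_tnth => i; rewrite -!perext_tnth; apply/eqP.
  rewrite -(eqr_nat R); apply/eqP/(mulIf (a0 i 0)).
  by have := s2 i 0; rewrite r2 => /addIr.
- apply/matrixP => k l; apply: (@intr_inj R).
  have := congr1 (fun A : 'M[R]_2 => A k l) (etrans (esym eM) eN).
  by rewrite [LHS]mxE [RHS]mxE.
Qed.

(** [tiling_quiddity] gives [q] and, applied to the transposed tiling, [q']; [M] is the corner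
    block. *)
Lemma toric_corresponds n m (a : int -> int -> R) :
    (2 <= n)%N -> (2 <= m)%N -> toric_tiling n m a ->
  exists2 t : triple n m, admissible t & corresponds t a.
Proof.
move=> n2 m2 ta; have [det pn pm pos] := ta.
have [q hq rq] := tiling_quiddity n2 m2 ta.
have [q' hq' rq'] := tiling_quiddity m2 n2 (toric_tiling_tr ta).
pose M : 'M[int]_2 := \matrix_(k, l) Num.floor (a (k : nat)%:Z (l : nat)%:Z).
have aM (k l : 'I_2) : a (k : nat)%:Z (l : nat)%:Z = (M k l)%:~R /\ 0 < M k l.
  have [] := pos k l; [have := ltn_ord k; lia | have := ltn_ord l; lia |].
  move=> h1 h2; rewrite mxE floorK //; split=> //.
  by rewrite -(ltr0z R) floorK.
have e k l := (aM k l).1; have Mgt0 k l := (aM k l).2.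
have e00 : a 0 0 = (M 0 0)%:~R by exact: (e 0 0).
have e01 : a 0 1 = (M 0 1)%:~R by exact: (e 0 1).
have e10 : a 1 0 = (M 1 0)%:~R by exact: (e 1 0).
have e11 : a 1 1 = (M 1 1)%:~R by exact: (e 1 1).
exists (q, q', M); last first.
  split=> [|i j|]; [exact: rq | exact: (rq' j i) |].
  by apply/matrixP => k l; rewrite mxE [RHS]mxE e.
split=> //; first split=> //.
- apply: (@intr_inj R); rewrite rmorphB !rmorphM /= -e00 -e01 -e10 -e11.
  exact: (det 0 0).
(* The inequality amounts to [a 0 (-1) < 0], and [a 0 (-1) = - a 0 (n - 1)] with [a 0 (n - 1)]
   positive. *)
- rewrite ltr_pdivlMr ?ltr0z // pmulrn -intrM ltr_int -(ltr_int R) intrM -pmulrn.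
  rewrite -e00 -e01 -subr_lt0.
  have := rq 0 0; rewrite add0r sub0r => ->.
  rewrite opprB addrC subrK -[a 0 (-1)]opprK -pn oppr_lt0.
  by have [|| //] := pos 0 (-1 + n%:Z); lia.
- rewrite ltr_pdivlMr ?ltr0z // pmulrn -intrM ltr_int -(ltr_int R) intrM -pmulrn.
  rewrite -e00 -e10 -subr_lt0.
  have := rq' 0 0; rewrite add0r sub0r => ->.
  rewrite opprB addrC subrK -[a (-1) 0]opprK -pm oppr_lt0.
  by have [|| //] := pos (-1 + m%:Z) 0; lia.
Qed.
End Tilings.

Theorem theorem4p1 (R : realType) (n m : nat) (hn : (2 <= n)%N) (hm : (2 <= m)%N) :
  exists Phi : triple n m -> (int -> int -> R),
    set_bij (@admissible n m) (@toric_tiling R n m) Phi /\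
    forall t, admissible t ->
      forall a : int -> int -> R, corresponds t a <-> a = Phi t.
Proof.
(* [Phi] chooses an array for each triple; uniqueness of that array identifies any other
   corresponding one with it. *)
have /choice[Phi PhiP] := @corresponds_exists R n m.
have toric t : admissible t -> toric_tiling n m (Phi t).
  by move=> adm; apply: corresponds_toric (PhiP t).
exists Phi; split; last first.
  move=> t _ a; split=> [ca|->]; last exact: PhiP.
  exact: corresponds_unique ca (PhiP t).
split=> [t|t t' /set_mem adm _ eqPhi|a ta].
- exact: toric.
- apply: corresponds_inj (PhiP t) _; last by rewrite eqPhi; exact: PhiP.
  by apply: toric_tiling_neq0 (toric t adm); lia.
- have [t adm ca] := toric_corresponds hn hm ta; exists t => //.
  exact: corresponds_unique (PhiP t) ca.
Qed.
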